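(* Let $k$ be a field and let $\mathcal A$ be a finite set of hyperplanes through the origin in $\mathbb R^d$, with face semigroup $\mathcal F$, intersection lattice $\mathcal L$ and face semigroup algebra $k\mathcal F$. The (left) $k\mathcal F$-modules $k\mathcal F_X$, $X\in\mathcal L$, are (up to isomorphism) all the projective indecomposable $k\mathcal F$-modules. Moreover, for every $X\in\mathcal L$ the radical of $k\mathcal F_X$ is $\operatorname{span}_k\{y-y' \mid y,y'\in\mathcal F_X\}$.
   Context: For each $H\in\mathcal A$ fix a labelling $H^+,H^-$ of the two open half-spaces determined by $H$, and put $H^0=H$. A face of $\mathcal A$ is a nonempty set of the form $x=\bigcap_{H\in\mathcal A}H^{\sigma_H}$ with $\sigma_H\in\{+,-,0\}$; write $\sigma_H(x)=\sigma_H$. $\mathcal F$ is the set of faces. The support of a face is $\operatorname{supp}(x)=\bigcap_{H:\sigma_H(x)=0}H$ (equal to $\mathbb R^d$ if no $\sigma_H(x)$ is $0$). The intersection lattice $\mathcal L=\operatorname{supp}(\mathcal F)$ (equivalently, the set of intersections of subsets of $\mathcal A$) is ordered by inclusion. The product $xy$ of faces is the face with $\sigma_H(xy)=\sigma_H(x)$ if $\sigma_H(x)\ne0$ and $\sigma_H(xy)=\sigma_H(y)$ if $\sigma_H(x)=0$. This makes $\mathcal F$ a semigroup with identity $1=\bigcap_{H\in\mathcal A}H$, and $k\mathcal F$ is its semigroup algebra over $k$. For $X\in\mathcal L$, $\mathcal F_X$ is the set of faces of support $X$, and $k\mathcal F_X$ is the $k$-vector space with basis $\mathcal F_X$, made into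 a left $k\mathcal F$-module by $y\cdot x=yx$ if $\operatorname{supp}(y)\le\operatorname{supp}(x)$ and $y\cdot x=0$ otherwise, for $y\in\mathcal F$, $x\in\mathcal F_X$. *)

(* Defs.v *)
From HB Require Import structures.
From mathcomp Require Import all_boot all_order all_algebra.
From mathcomp Require Import finmap.
From mathcomp Require Import boolp classical_sets reals.
From mathcomp Require Import monalg.

Set Implicit Arguments.
Unset Strict Implicit.
Unset Printing Implicit Defensive.

Import Order.TTheory GRing.Theory Num.Theory.

Local Open Scope fset_scope.
Local Open Scope classical_set_scope.
Local Open Scope ring_scope.

(** Modules are left modules, of arbitrary dimension, and module morphisms are
    the [{linear M -> N}] of the library. *)

Section Modules.
Variable S : nzRingType.

Definition projective (P : lmodType S) : Prop :=
  forall (M N : lmodType S) (g : {linear M -> N}) (f : {linear P -> N}),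
    (forall n : N, exists m : M, g m = n) ->
    exists h : {linear P -> M}, forall p : P, g (h p) = f p.

Definition direct_sum (M : lmodType S) (U V : {pred M}) : Prop :=
  (forall x : M, exists u v : M, [/\ u \in U, v \in V & x = u + v]) /\
  (forall x : M, x \in U -> x \in V -> x = 0).

Definition indecomposable (M : lmodType S) : Prop :=
  (exists x : M, x != 0) /\
  forall U V : {pred M},
    GRing.submod_closed U -> GRing.submod_closed V -> direct_sum U V ->
    (forall x, x \in U -> x = 0) \/ (forall x, x \in V -> x = 0).

Definition isomorphic (M N : lmodType S) : Prop :=
  exists f : {linear M -> N}, bijective f.

Definition proper_submodule (M : lmodType S) (N : {pred M}) : Prop :=
  GRing.submod_closed N /\ exists x : M, x \notin N.

Definition maximal_submodule (M : lmodType S) (N : {pred M}) : Prop :=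
  proper_submodule N /\
  forall N' : {pred M}, proper_submodule N' ->
    {subset N <= N'} -> {subset N' <= N}.

Definition radical (M : lmodType S) : set M :=
  [set x | forall N : {pred M}, maximal_submodule N -> x \in N].

End Modules.

Arguments radical {S} M.

(** A labelling of the two open half-spaces of a hyperplane [H] is given by a
    linear form with kernel [H]; [Plus] is the side where it is positive. *)

Record arrangement (R : realType) (d : nat) := Arrangement {
  hyperplanes : {fset {vspace 'rV[R]_d}};
  label : hyperplanes -> 'Hom('rV[R]_d, R^o);
  dim_hyperplane : forall H : hyperplanes, (\dim (val H)).+1 = d;
  lker_label : forall H : hyperplanes, lker (label H) = val H
}.

Inductive sign := Plus | Minus | Zero.

Definition sign_code (s : sign) : option bool :=
  match s with Plus => Some true | Minus => Some false | Zero => None end.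
Definition sign_decode (o : option bool) : sign :=
  match o with Some true => Plus | Some false => Minus | None => Zero end.
Lemma sign_codeK : cancel sign_code sign_decode.
Proof. by case. Qed.
HB.instance Definition _ := Finite.copy sign (can_type sign_codeK).

Section Faces.
Variables (R : realType) (d : nat) (A : arrangement R d).
Implicit Types (H : hyperplanes A) (v : 'rV[R]_d).

Definition half_space H (s : sign) : set 'rV[R]_d :=
  match s with
  | Plus => [set v | 0 < (label H v : R)]
  | Minus => [set v | (label H v : R) < 0]
  | Zero => [set v | v \in val H]
  end.

Definition cell (s : {ffun hyperplanes A -> sign}) : set 'rV[R]_d :=
  \bigcap_(H in [set: hyperplanes A]) half_space H (s H).

(** A face is encoded by its sign vector; [cell_sigma_inj] below shows that the
    set of points of a face determines its sign vector. *)
Record face := Face {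
  sigma : {ffun hyperplanes A -> sign};
  cell_neq0 : `[< cell sigma !=set0 >]
}.

HB.instance Definition _ := [isSub for sigma].
HB.instance Definition _ := [Finite of face by <:].

Definition sgn_of (r : R) : sign :=
  if 0 < r then Plus else if r < 0 then Minus else Zero.

Lemma half_spaceP H s v : half_space H s v <-> s = sgn_of (label H v).
Proof.
rewrite /sgn_of; case: s => /=.
- by case: ltgtP.
- by case: ltgtP.
- rewrite -(lker_label H) memv_ker.
  by case: (ltgtP 0 (label H v : R)) => [h|h|h]; split => // /eqP h';
     move: h; rewrite h' ltxx.
Qed.

Lemma cellP (s : {ffun hyperplanes A -> sign}) v :
  cell s v <-> forall H, s H = sgn_of (label H v).
Proof.
split=> [h H|h H _]; first by apply/half_spaceP; exact: h.
by apply/half_spaceP; exact: h.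
Qed.

Lemma cell_sigma_inj : injective (fun x : face => cell (sigma x)).
Proof.
move=> x y exy; apply: val_inj; apply/ffunP => H /=.
have /asboolP[v hx] := cell_neq0 x.
have hy : cell (sigma y) v by rewrite -exy.
by move/cellP: hx => ->; move/cellP: hy => ->.
Qed.

Definition support (x : face) : {vspace 'rV[R]_d} :=
  (\bigcap_(H : hyperplanes A | sigma x H == Zero) val H)%VS.

Definition intersection_lattice : {fset {vspace 'rV[R]_d}} :=
  [fset support x | x in [set: face]%SET].

Definition sign_mul (s t : {ffun hyperplanes A -> sign}) :
    {ffun hyperplanes A -> sign} :=
  [ffun H => if s H != Zero then s H else t H].

Lemma sign_mul_neq0 (x y : face) :
  `[< cell (sign_mul (sigma x) (sigma y)) !=set0 >].
Proof.
have /asboolP[v /cellP hv] := cell_neq0 x.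
have /asboolP[w /cellP hw] := cell_neq0 y.
pose q H := `|label H w : R| / `|label H v : R|.
pose e : R := (1 + \sum_H q H)^-1.
have q0 H : 0 <= q H by rewrite divr_ge0.
have s0 : 0 < 1 + \sum_H q H by rewrite ltr_pwDl // sumr_ge0.
have e0 : 0 < e by rewrite invr_gt0.
apply/asboolP; exists (v + e *: w); apply/cellP => H; rewrite ffunE hv hw.
rewrite linearD linearZ /=.
set a := (label H v : R); set b := (label H w : R).
rewrite -[_ *: _]/(e * b) -[_ + _]/(a + e * b).
have [a0|a0] := eqVneq a 0.
  by rewrite a0 add0r /sgn_of ltxx /= pmulr_rgt0 // pmulr_rlt0.
have : `|e * b| < `|a|.
  have na : 0 < `|a| by rewrite normr_gt0.
  rewrite normrM (gtr0_norm e0) mulrC ltr_pdivrMr // mulrC -ltr_pdivrMr //.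
  apply: (@le_lt_trans _ _ (\sum_H q H)); last by rewrite ltrDr.
  by rewrite (bigD1 H) //= lerDl sumr_ge0.
rewrite /sgn_of; case: (ltgtP a 0) a0 => // ha _.
  rewrite (ltr0_norm ha) ltr_norml => /andP[_ hb].
  by rewrite /= (lt_gtF (_ : a + e * b < 0)) -ltrBrDl sub0r ?hb.
by rewrite (gtr0_norm ha) ltr_norml => /andP[hb _]; rewrite /= -ltrBlDl sub0r hb.
Qed.

Definition face_mul (x y : face) : face := Face (sign_mul_neq0 x y).

Lemma sign_one_neq0 : `[< cell [ffun=> Zero] !=set0 >].
Proof.
apply/asboolP; exists 0; apply/cellP => H.
by rewrite ffunE linear0 /sgn_of ltxx.
Qed.

Definition face_one : face := Face sign_one_neq0.

Lemma face_mulA : associative face_mul.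
Proof.
move=> x y z; apply: val_inj; apply/ffunP => H; rewrite !ffunE.
by case: (sigma x H).
Qed.

Lemma face_mul1 : left_id face_one face_mul.
Proof. by move=> x; apply: val_inj; apply/ffunP => H; rewrite !ffunE eqxx. Qed.

Lemma face_mulr1 : right_id face_one face_mul.
Proof.
by move=> x; apply: val_inj; apply/ffunP => H; rewrite !ffunE; case: eqP.
Qed.

Lemma face_mul_eq1 x y :
  face_mul x y = face_one -> x = face_one /\ y = face_one.
Proof.
move=> /(congr1 (fun z : face => sigma z)) /ffunP e.
by split; apply: val_inj; apply/ffunP => H; move: (e H); rewrite !ffunE;
   case: eqP.
Qed.

HB.instance Definition _ :=
  Choice_isMonomialDef.Build face face_mulA face_mul1 face_mulr1 face_mul_eq1.

Lemma supportS (x y : face) :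
  reflect (forall H, sigma y H = Zero -> sigma x H = Zero)
          (support x <= support y)%VS.
Proof.
apply: (iffP idP) => [xy H yH|xy]; last first.
  by apply/subv_bigcapP => H /eqP/xy xH; rewrite (bigcapv_inf H) // xH.
have /asboolP[v hv] := cell_neq0 x; move/cellP: (hv) => ->.
apply/esym/half_spaceP => /=; suff: v \in support y.
  by apply/subvP; rewrite /support (bigcapv_inf H) // yH.
apply: (subvP xy); rewrite memvE; apply/subv_bigcapP => K /eqP xK.
by rewrite -memvE; have := hv K I; rewrite xK.
Qed.

Lemma support_eq (x y : face) :
  (forall H, (sigma x H == Zero) = (sigma y H == Zero)) ->
  support x = support y.
Proof. by move=> xy; apply: eq_bigl. Qed.

Lemma support_mulr (y x : face) :
  (support y <= support x)%VS -> support (mmul y x) = support x.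
Proof.
move/supportS => yx; apply: support_eq => H; rewrite ffunE.
case: (eqVneq (sigma y H) Zero) => //= yH; rewrite (negPf yH).
by apply/esym/negP => /eqP/yx yH0; rewrite yH0 eqxx in yH.
Qed.

Lemma support_mulS (y z x : face) :
  (support (mmul y z) <= support x)%VS =
  (support y <= support x)%VS && (support z <= support x)%VS.
Proof.
apply/supportS/andP => [h|[/supportS h1 /supportS h2] H xH].
  by split; apply/supportS => H /h; rewrite ffunE; case: eqP.
by rewrite ffunE h1 // h2.
Qed.

Lemma support1 (x : face) : (support mone <= support x)%VS.
Proof. by apply/supportS => H _; rewrite ffunE. Qed.

End Faces.

Section FaceModules.
Variables (R : realType) (d : nat) (A : arrangement R d) (k : fieldType).

Definition face_algebra := {malg k[face A]}.

Variable X : {vspace 'rV[R]_d}.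

Definition faces_on : predArgType := {x : face A | support x == X}.

Definition face_space := {ffun faces_on -> k^o}.

(** The basis vector of a face of support [X]; for other faces it is [0]. *)
Definition face_vec (z : face A) : face_space :=
  [ffun x : faces_on => ((val x == z)%:R : k^o)].

Definition difference_span : {vspace face_space} :=
  <<[seq face_vec (val y) - face_vec (val y')
      | y <- enum faces_on, y' <- enum faces_on]>>%VS.

Definition face_act (y : face A) (x : faces_on) : face_space :=
  if (support y <= support (val x))%VS then face_vec (mmul y (val x)) else 0.

Definition face_scale (a : face_algebra) (u : face_space) : face_space :=
  \sum_(y : face A) \sum_(x : faces_on) (a@_y * u x : k) *: face_act y x.

(** [face_module] is [face_space] with [face_algebra] as ring of scalars. *)
Definition face_module := face_space.

HB.instance Definition _ := GRing.Zmodule.copy face_module face_space.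

Lemma faces_onP (x : faces_on) : support (val x) = X.
Proof. exact/eqP/(valP x). Qed.

(** [face_act y u] extended linearly in [u]. *)
Let act (y : face A) (u : face_space) : face_space :=
  \sum_(x : faces_on) (u x : k) *: face_act y x.

Let actZ y c u : act y (c *: u) = c *: act y u.
Proof.
by rewrite scaler_sumr; apply: eq_bigr => x _; rewrite ffunE scalerA.
Qed.

Let actD y u v : act y (u + v) = act y u + act y v.
Proof.
by rewrite -big_split; apply: eq_bigr => x _; rewrite ffunE scalerDl.
Qed.

Let act_sum y (I : finType) (F : I -> face_space) :
  act y (\sum_i F i) = \sum_i act y (F i).
Proof.
have a0 : act y 0 = 0.
  by rewrite /act big1 // => x _; rewrite ffunE scale0r.
by elim/big_rec2: _ => [//|i u v _ <-]; rewrite actD.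
Qed.

Let act_vec y (x : faces_on) : act y (face_vec (val x)) = face_act y x.
Proof.
rewrite /act (bigD1 x) //= ffunE eqxx scale1r big1 ?addr0 // => z zx.
by rewrite ffunE val_eqE (negPf zx) scale0r.
Qed.

Let scaleE (a : face_algebra) u : face_scale a u = \sum_y a@_y *: act y u.
Proof.
apply: eq_bigr => y _; rewrite scaler_sumr.
by apply: eq_bigr => x _; rewrite scalerA.
Qed.

Let actM y z u : act y (act z u) = act (mmul y z) u.
Proof.
rewrite {2}/act act_sum; apply: eq_bigr => x _; rewrite actZ; congr (_ *: _).
rewrite /face_act support_mulS.
case: ifP => zx; last first.
  rewrite andbF; have := actZ y 0 0; rewrite !scale0r => e; exact: e.
rewrite andbT; have zX : support (mmul z (val x)) == X.
  by rewrite support_mulr // (faces_onP x).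
pose w : faces_on := exist (fun x => is_true (support x == X)) _ zX.
rewrite -[mmul z _]/(val w) act_vec /face_act /=.
by rewrite (eqP zX) (faces_onP x) mulmA.
Qed.

Let act1 u : act mone u = u.
Proof.
apply/ffunP => x; rewrite /act sum_ffunE (bigD1 x) //= big1 => [|z zx].
  rewrite addr0 /face_act support1 mul1m !ffunE eqxx.
  exact: mulr1.
by rewrite /face_act support1 mul1m !ffunE val_eqE eq_sym (negPf zx); exact: mulr0.
Qed.

Let mcoeffM (a b : face_algebra) w :
  (a * b)@_w = \sum_y \sum_z (a@_y * b@_z) *+ (mmul y z == w).
Proof.
pose D := [fset y | y in [set: face A]%SET].
have allD y : y \in D by apply/imfsetP; exists y; rewrite // inE.
have sumD (F : face A -> k) : \sum_(y <- D) F y = \sum_y F y.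
  by rewrite big_uniq ?fset_uniq //; apply: eq_bigl => y; rewrite allD.
rewrite (@mcoeffMlw _ _ D D); try by apply/fsubsetP => y _; exact: allD.
by rewrite sumD; apply: eq_bigr => y _; rewrite sumD.
Qed.

Lemma face_scaleA (a b : face_algebra) (u : face_module) :
  face_scale a (face_scale b u) = face_scale (a * b) u.
Proof.
rewrite !scaleE.
transitivity (\sum_y \sum_z (a@_y * b@_z) *: act (mmul y z) u).
  apply: eq_bigr => y _; rewrite act_sum scaler_sumr; apply: eq_bigr => z _.
  by rewrite actZ actM scalerA.
transitivity (\sum_w \sum_y \sum_z
    ((a@_y * b@_z) *+ (mmul y z == w)) *: act w u); last first.
  apply: eq_bigr => w _; rewrite mcoeffM scaler_suml.
  by apply: eq_bigr => y _; rewrite scaler_suml.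
rewrite [RHS]exchange_big; apply: eq_bigr => y _.
rewrite [RHS]exchange_big; apply: eq_bigr => z _.
rewrite (bigD1 (mmul y z)) //= eqxx big1 ?addr0 // => w.
by rewrite eq_sym => /negPf ->; rewrite scale0r.
Qed.

Lemma face_scale1 (u : face_module) : face_scale (1 : face_algebra) u = u.
Proof.
rewrite scaleE (bigD1 (mone : face A)) //= mcoeff1 eqxx scale1r act1 big1 ?addr0 //.
by move=> y /negPf y1; rewrite mcoeff1 y1 scale0r.
Qed.

Lemma face_scaleDr (a : face_algebra) (u v : face_module) :
  face_scale a (u + v) = face_scale a u + face_scale a v :> face_module.
Proof.
rewrite !scaleE -big_split; apply: eq_bigr => y _.
by rewrite actD scalerDr.
Qed.

Lemma face_scaleDl (u : face_module) (a b : face_algebra) :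
  face_scale (a + b) u = face_scale a u + face_scale b u :> face_module.
Proof.
rewrite !scaleE -big_split; apply: eq_bigr => y _.
by rewrite mcoeffD scalerDl.
Qed.

HB.instance Definition _ := GRing.Zmodule_isLmodule.Build face_algebra
  face_module face_scaleA face_scale1 face_scaleDr face_scaleDl.

Lemma scale_face (y : face A) (x : faces_on) :
  (<< y >> : face_algebra) *: (face_vec (val x) : face_module) = face_act y x.
Proof.
rewrite -[LHS]/(face_scale _ _) scaleE (bigD1 y) //= big1 => [|z].
  by rewrite mcoeffU1 eqxx scale1r act_vec addr0.
by rewrite eq_sym mcoeffU1 => /negPf ->; rewrite scale0r.
Qed.

End FaceModules.

(* Main.v *)
Require Import Defs.
From HB Require Import structures.
From mathcomp Require Import all_boot all_order all_algebra.
From mathcomp Require Import finmap.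
From mathcomp Require Import boolp classical_sets reals.
From mathcomp Require Import monalg.

Set Implicit Arguments.
Unset Strict Implicit.
Unset Printing Implicit Defensive.

Import GRing.Theory.

Local Open Scope fset_scope.
Local Open Scope classical_set_scope.
Local Open Scope ring_scope.

(** Write [kF] for the face algebra and [kF_X] for [face_module A k X]. For a
    subspace [X] let [chi_X] be the character of [kF] with [chi_X y = 1] if
    [support y <= X] and [chi_X y = 0] otherwise; in terms of coefficients it is
    [coeff_sum_below X]. The sum of coordinates [face_sum] on [kF_X] satisfies
    [face_sum (a *: u) = chi_X a * face_sum u].

    Everything about a single [kF_X] comes from one remark: faces [y] and [x] of
    the same support satisfy [y x = y], so an element [u] with [face_sum u != 0]
    generates [kF_X] (lemma [face_generates]). Hence the kernel of [face_sum],
    which is the span of the differences of faces, contains every proper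
    submodule. It is therefore the radical, and [kF_X] is indecomposable since
    one of the two summands of a decomposition must contain an element of
    non-zero sum.

    For projectivity, let [e_X] be the product of the [1 - z] over the faces [z]
    whose support is not contained in [X]. Because [y z y = y z] for all faces,
    [y e_X = 0] as soon as [support y] is not contained in [X]; and [e_X] acts
    as the identity on [kF_X], since each such [z] acts by zero there. So
    [u |-> u e_X] is a morphism from [kF_X] to [kF], and for [x] of support [X]
    the morphism [a |-> a *: x] from [kF] to [kF_X] is a left inverse of it:
    [kF_X] is a direct summand of [kF].

    Conversely let [P] be projective and indecomposable. A section of a free
    cover of [P] writes each [p] as a sum of terms [f_q(p) *: q] with [f_q]
    linear from [P] to [kF]. If every [f_q(p)] were killed by every
    [chi_(support z)], then [P] would vanish: multiplying a face [z] by an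
    element killed by [chi_(support z)] leaves only faces with more non-zero
    signs than [z], so induction gives [z *: p = 0] for all [z] and [p], in
    particular for [z = 1]. Thus [chi_(support z) (f_q(p)) != 0] for some [q],
    [p] and [z]; then [p |-> f_q(p) *: z] hits an element of non-zero sum, so it
    maps [P] onto [kF_(support z)]. It splits because the target is projective,
    and indecomposability of [P] makes it an isomorphism. *)

(** * Modules and products over an arbitrary ring *)

Section ModuleTheory.
Variable S : nzRingType.

Lemma submodule_scale (M : lmodType S) (N : {pred M}) (a : S) (u : M) :
  GRing.submod_closed N -> u \in N -> a *: u \in N.
Proof. by move=> [N0 Nlin] Nu; rewrite -[_ *: _]addr0 Nlin. Qed.

Section Evaluation.
Variable P : lmodType S.

Definition free_eval (a : {malg S[P]}) : P := \sum_(q <- msupp a) a@_q *: q.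

Lemma free_evalEw (D : {fset P}) (a : {malg S[P]}) :
  (msupp a `<=` D)%fset -> free_eval a = \sum_(q <- D) a@_q *: q.
Proof.
move=> aD; apply: big_fset_incl => // q _ qa.
by rewrite mcoeff_outdom ?scale0r.
Qed.

Lemma free_eval_is_linear : linear free_eval.
Proof.
move=> c a b; pose D := (msupp (c *: a + b) `|` (msupp a `|` msupp b))%fset.
rewrite !(@free_evalEw D) ?fsubsetUl //.
- rewrite scaler_sumr -big_split; apply: eq_bigr => q _ /=.
  by rewrite mcoeffD mcoeffZ scalerDl scalerA.
- by apply: fsubset_trans (fsubsetUr _ _); apply: fsubsetUr.
- by apply: fsubset_trans (fsubsetUr _ _); apply: fsubsetUl.
Qed.

HB.instance Definition _ :=
  GRing.isLinear.Build S {malg S[P]} P *:%R free_eval free_eval_is_linear.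

Lemma free_evalU (q : P) : free_eval << q >> = q.
Proof. by rewrite (free_evalEw msuppU_le) big_seq_fset1 mcoeffUU scale1r. Qed.

(** A linear section of the free cover of [P] on the set of its own elements;
    its coordinates are linear forms on [P], the dual basis. *)
Lemma projective_dual_basis : projective P ->
  exists h : {linear P -> {malg S[P]}},
    forall p, p = \sum_(q <- msupp (h p)) (h p)@_q *: q.
Proof.
move=> /(_ _ _ free_eval idfun)[|h hK].
  by move=> q; exists << q >>; exact: free_evalU.
by exists h => p; rewrite -[LHS]hK.
Qed.

End Evaluation.

(** The surjection splits, so that [P] is the direct sum of its kernel and of a
    copy of [Q]; the latter is not zero, hence the kernel is. *)
Lemma indecomposable_surj (P Q : lmodType S) (f : {linear P -> Q}) :
  indecomposable P -> projective Q -> (exists q : Q, q != 0) ->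
  (forall q, exists p, f p = q) -> bijective f.
Proof.
move=> [_ indP] projQ [q q0] fsurj.
have [s fs] := projQ _ _ f idfun fsurj; rewrite /= in fs.
pose U : {pred P} := [pred p | `[< exists q, s q = p >]].
pose V : {pred P} := [pred p | f p == 0].
case: (indP U V).
- split; first by apply/asboolP; exists 0; rewrite linear0.
  move=> a _ _ /asboolP[x <-] /asboolP[y <-].
  by apply/asboolP; exists (a *: x + y); rewrite linearP.
- split; first by rewrite !inE linear0.
  by move=> a x y; rewrite !inE linearP => /eqP-> /eqP->; rewrite scaler0 addr0.
- split=> [p|p /asboolP[x <-]].
    exists (s (f p)), (p - s (f p)); split; last by rewrite subrKC.
      by apply/asboolP; exists (f p).
    by rewrite !inE linearB /= fs subrr.
  by rewrite !inE fs => /eqP->; rewrite linear0.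
- move=> U0; case/eqP: q0; rewrite -[q]fs (U0 (s q)) ?linear0 //.
  by apply/asboolP; exists q.
- move=> V0; exists s => // p; apply/esym/eqP; rewrite -subr_eq0; apply/eqP.
  by apply: V0; rewrite !inE linearB /= fs subrr.
Qed.

(** The property [a * e y = a] survives the multiplication of [a] by a factor
    [1 - e z], and the factor [1 - e y] kills such an [a]; so the order of the
    factors does not matter. *)
Lemma prod_1B_band_eq0 (I : eqType) (e : I -> S) (s : seq I) (Q : pred I)
    (y : I) (a : S) :
  (forall z, e y * e z * e y = e y * e z) -> y \in s -> Q y -> a * e y = a ->
  a * \prod_(z <- s | Q z) (1 - e z) = 0.
Proof.
move=> band + Qy; elim: s a => // z s IH a; rewrite inE big_cons.
have [<- _ ay|yz /= ys ay] := eqVneq y z.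
  by rewrite Qy mulrA mulrBr mulr1 ay subrr mul0r.
case: ifP => _; last exact: IH.
rewrite mulrA; apply: IH => //.
rewrite mulrBr mulr1 mulrBl ay; congr (_ - _).
by rewrite -ay -!mulrA (mulrA (e y)) band.
Qed.

End ModuleTheory.

(** * The face algebra *)

(** Sealed, like [face_coeff] below, so that comparing two elements of the
    algebra up to conversion does not unfold finitely supported functions. *)
HB.lock Definition face_term (R : realType) (d : nat) (A : arrangement R d)
  (k : fieldType) (c : k) (y : face A) : {malg k[face A]} := << c *g y >>.

HB.lock Definition face_coeff (R : realType) (d : nat) (A : arrangement R d)
  (k : fieldType) (a : {malg k[face A]}) (y : face A) : k := a@_y.

Section FaceAlgebra.
Variables (R : realType) (d : nat) (A : arrangement R d) (k : fieldType).
Local Notation kF := {malg k[face A]}.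
Local Notation support := (@Defs.support R d A).
Local Notation face_term := (@face_term R d A k).
Local Notation face_coeff := (@face_coeff R d A k).
Implicit Types (x y z : face A) (a b : kF).

Lemma face_mul_absorb x y : (support y <= support x)%VS -> mmul x y = x.
Proof.
move=> /supportS yx; apply: val_inj; apply/ffunP => H; rewrite ffunE.
by case: eqP => //= xH; rewrite xH yx.
Qed.

Lemma face_mul_band y z : mmul (mmul y z) y = mmul y z.
Proof.
apply: face_mul_absorb; apply/supportS => H; rewrite ffunE.
by case: eqP => [->|].
Qed.

Lemma face_coeff_term c y z : face_coeff (face_term c y) z = c *+ (y == z).
Proof. by rewrite face_coeff.unlock face_term.unlock; exact: mcoeffU. Qed.

Lemma face_termD (b c : k) z :
  face_term (b + c) z = face_term b z + face_term c z.
Proof. by rewrite face_term.unlock; exact: monalgUD. Qed.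

Lemma face_term0 z : face_term 0 z = 0.
Proof. by rewrite face_term.unlock; exact: monalgU0. Qed.

Lemma face_term_sum (I : Type) (r : seq I) (Q : pred I) (c : I -> k) z :
  face_term (\sum_(i <- r | Q i) c i) z = \sum_(i <- r | Q i) face_term (c i) z.
Proof.
by elim/big_rec2: _ => [|i u v _ <-]; rewrite ?face_term0 ?face_termD.
Qed.

Lemma face_coeff_sum (I : Type) (r : seq I) (Q : pred I) (F : I -> kF) z :
  face_coeff (\sum_(i <- r | Q i) F i) z =
  \sum_(i <- r | Q i) face_coeff (F i) z.
Proof.
by rewrite face_coeff.unlock; exact: (big_morph _ (mcoeffD z) (mcoeff0 z)).
Qed.

Lemma face_term1 : face_term 1 mone = 1.
Proof. by rewrite face_term.unlock. Qed.

Lemma face_termM (b c : k) y z :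
  face_term b y * face_term c z = face_term (b * c) (mmul y z).
Proof. by rewrite face_term.unlock malgM_def fgmulUU. Qed.

Lemma face_algebraP a b : (forall y, face_coeff a y = face_coeff b y) -> a = b.
Proof. by rewrite face_coeff.unlock => ab; apply/malgP. Qed.

Lemma face_algebraE a : a = \sum_y face_term (face_coeff a y) y.
Proof.
apply: face_algebraP => z; rewrite face_coeff_sum (bigD1 z) //=.
rewrite face_coeff_term eqxx big1 ?addr0 // => y /negPf yz.
by rewrite face_coeff_term yz.
Qed.

(** The element [e_X]. It depends on the enumeration of the
    faces, but the two properties that matter do not:
    [mul_upper_annihilated] and [upper_annihilated_id]. *)
Definition upper_annihilated (X : {vspace 'rV[R]_d}) : kF :=
  \prod_(z : face A | ~~ (support z <= X)%VS) (1 - face_term 1 z).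

Lemma mul_upper_annihilated (X : {vspace 'rV[R]_d}) y :
  ~~ (support y <= X)%VS -> face_term 1 y * upper_annihilated X = 0.
Proof.
move=> yX; apply: (@prod_1B_band_eq0 _ _ (fun z => face_term 1 z)).
- by move=> z; rewrite !face_termM face_mul_band !mulr1.
- exact: mem_index_enum.
- exact: yX.
- by rewrite face_termM mulr1 face_mul_absorb.
Qed.

(** The value at [a] of the character [chi_X]. *)
Definition coeff_sum_below (X : {vspace 'rV[R]_d}) a : k :=
  \sum_(y | (support y <= X)%VS) face_coeff a y.

(** A rank function: it replaces the dimension of the support in inductions,
    since by [num_nonzero_mul] it grows along with the support. *)
Definition num_nonzero x : nat := #|[pred H | sigma x H != Zero]|.

Lemma num_nonzero_mul y z :
  ~~ (support y <= support z)%VS -> (num_nonzero z < num_nonzero (mmul z y))%N.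
Proof.
move=> yz; apply: proper_card; apply/properP; split.
  by apply/fintype.subsetP => H; rewrite !inE ffunE => zH; rewrite zH.
have [H zH yH] : exists2 H, sigma z H = Zero & sigma y H != Zero.
  apply: contrapT => h; case/negP: yz; apply/supportS => H zH.
  by apply/eqP/negPn/negP => yH; apply: h; exists H.
by exists H; rewrite !inE ?ffunE zH ?eqxx.
Qed.

(** The faces [y] of support inside [support z] satisfy [z y = z]: together they
    contribute [chi_(support z) a] times [z], which is zero. *)
Lemma mul_face_coeff_sum z a : coeff_sum_below (support z) a = 0 ->
  face_term 1 z * a =
  \sum_(y | ~~ (support y <= support z)%VS)
     face_term (face_coeff a y) mone * face_term 1 (mmul z y).
Proof.
move=> a0.
have -> : face_term 1 z * a = \sum_y face_term (face_coeff a y) (mmul z y).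
  rewrite {1}(face_algebraE a) mulr_sumr; apply: eq_bigr => y _.
  by rewrite face_termM mul1r.
rewrite (bigID (fun y => (support y <= support z)%VS)).
rewrite (eq_bigr (fun y => face_term (face_coeff a y) z)); last first.
  by move=> y yz; rewrite face_mul_absorb.
rewrite -face_term_sum [X in face_term X z]a0 face_term0 [LHS]add0r.
by apply: eq_bigr => y _; rewrite face_termM mulr1 mul1m.
Qed.

(** A form of Nakayama's lemma without finiteness assumption on [M]: the common
    kernel of the characters is a nilpotent ideal, because multiplying a face by
    one of its elements strictly increases the number of non-zero signs. *)
Lemma eq0_of_radical_coefficients (M : lmodType kF) :
  (forall m : M, exists (I : Type) (s : seq I) (c : I -> kF) (q : I -> M),
      m = \sum_(i <- s) c i *: q i /\
      forall i z, coeff_sum_below (support z) (c i) = 0) ->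
  forall m : M, m = 0.
Proof.
move=> JM m.
(* Descending induction on the number of non-zero signs of z, starting above the
   total number of hyperplanes. *)
suff kill n z (p : M) : (#|{: hyperplanes A}| - num_nonzero z < n)%N ->
    face_term 1 z *: p = 0.
  by rewrite -[m]scale1r -face_term1; apply: (kill _ _ _ (ltnSn _)).
elim: n z p => // n IH z p zn.
have [I [s [c [q [-> c0]]]]] := JM p.
rewrite scaler_sumr big1 // => i _.
rewrite scalerA mul_face_coeff_sum // scaler_suml big1 // => y yz.
rewrite -scalerA IH ?scaler0 //; move: zn; rewrite ltnS; apply: leq_trans.
apply: ltn_sub2l; last exact: num_nonzero_mul.
by apply: leq_trans (num_nonzero_mul yz) _; exact: max_card.
Qed.

(** * The modules attached to the subspaces *)

Section FaceModule.
Variable X : {vspace 'rV[R]_d}.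
Implicit Types (u v : face_space A k X).

Definition face_sum u : k := \sum_x u x.

Lemma face_sum_is_linear : linear_for *%R face_sum.
Proof.
move=> c u v; rewrite /face_sum mulr_sumr -big_split.
by apply: eq_bigr => x _; rewrite !ffunE.
Qed.

HB.instance Definition _ := GRing.isLinear.Build k (face_space A k X) k *%R
  face_sum face_sum_is_linear.

Lemma face_sum_vec (x : face A) :
  support x = X -> face_sum (face_vec k X x) = 1.
Proof.
move=> /eqP xX; rewrite /face_sum (bigD1 (Sub x xX : faces_on A X)) //=.
by rewrite ffunE eqxx big1 ?addr0 // => y; rewrite ffunE -val_eqE => /negPf->.
Qed.

Lemma face_spaceE u :
  u = \sum_(x : faces_on A X) (u x : k) *: face_vec k X (val x).
Proof.
apply/ffunP => y; rewrite sum_ffunE (bigD1 y) //= !ffunE eqxx big1 => [|x].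
  by rewrite addr0 [RHS]mulr1.
by rewrite !ffunE eq_sym -val_eqE => /negPf->; rewrite [LHS]mulr0.
Qed.

Lemma face_module_scaleE a (u : face_module A k X) : a *: u =
  \sum_y \sum_(x : faces_on A X) (face_coeff a y * u x) *: face_act k y x
  :> face_space A k X.
Proof. by rewrite face_coeff.unlock. Qed.

Lemma face_act_above y (x : faces_on A X) :
  ~~ (support y <= X)%VS -> face_act k y x = 0.
Proof. by rewrite /face_act faces_onP => /negPf->. Qed.

Lemma face_sum_act y (x : faces_on A X) :
  face_sum (face_act k y x) = (support y <= X)%VS%:R.
Proof.
rewrite /face_act faces_onP; case: ifP => yX; last exact: raddf0.
by rewrite face_sum_vec // support_mulr ?faces_onP.
Qed.

Lemma face_sum_scale a (u : face_module A k X) :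
  face_sum (a *: u) = coeff_sum_below X a * face_sum u.
Proof.
rewrite face_module_scaleE raddf_sum /coeff_sum_below mulr_suml [RHS]big_mkcond.
apply: eq_bigr => y _; rewrite raddf_sum.
transitivity
  (\sum_(x : faces_on A X) face_coeff a y * u x * (support y <= X)%VS%:R).
  by apply: eq_bigr => x _; rewrite /= linearZ /= face_sum_act.
case: ifP => yX; last by rewrite big1 // => x _; rewrite mulr0.
by rewrite mulr_sumr; apply: eq_bigr => x _; rewrite mulr1.
Qed.

(** The inclusion of [kF_X] in [kF]. It is not a morphism of modules, but it
    becomes one after right multiplication by [upper_annihilated X]: see
    [face_lift_equivariant]. *)
Definition face_lift u : kF := \sum_(x : faces_on A X) face_term (u x) (val x).

Lemma face_liftD : {morph face_lift : u v / u + v}.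
Proof.
move=> u v; rewrite -big_split; apply: eq_bigr => x _.
by rewrite ffunE face_termD.
Qed.

Lemma scale_faceU (c : k) y (u : face_module A k X) :
  face_term c y *: u =
  \sum_(x : faces_on A X) (c * u x) *: face_act k y x :> face_space A k X.
Proof.
rewrite face_module_scaleE (bigD1 y) //= face_coeff_term eqxx.
rewrite [X in _ + X]big1 ?addr0 // => z zy; rewrite big1 // => x _.
by rewrite face_coeff_term eq_sym (negPf zy) mul0r scale0r.
Qed.

(** The bilinear form of the identity [y x = y] for faces of equal support. *)
Lemma face_lift_scale v (u : face_module A k X) :
  face_lift v *: u = face_sum u *: v :> face_space A k X.
Proof.
rewrite [X in _ = _ *: X]face_spaceE scaler_sumr scaler_suml.
apply: eq_bigr => y _.
rewrite scale_faceU scalerA [_ * v y]mulrC mulr_sumr scaler_suml.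
apply: eq_bigr => x _; rewrite /face_act !faces_onP subvv face_mul_absorb //.
by rewrite !faces_onP.
Qed.

(** An element of non-zero sum generates: [v] is the multiple of [u] by the lift
    of [v], up to the scalar [face_sum u]. *)
Lemma face_generates (N : {pred face_module A k X}) (u : face_module A k X) :
  GRing.submod_closed N -> u \in N -> face_sum u != 0 -> forall v, v \in N.
Proof.
move=> Nsub Nu u0 v; pose w : face_space A k X := (face_sum u)^-1 *: v.
have -> : v = face_lift w *: u.
  by apply: etrans (esym (face_lift_scale w u)); rewrite scalerA mulfV ?scale1r.
exact: submodule_scale.
Qed.

Lemma face_liftZ (c : k) u :
  face_lift (c *: u) = face_term c mone * face_lift u.
Proof.
rewrite mulr_sumr; apply: eq_bigr => x _.
by rewrite ffunE face_termM mul1m.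
Qed.

Lemma face_lift_sum (I : Type) (r : seq I) (F : I -> face_space A k X) :
  face_lift (\sum_(i <- r) F i) = \sum_(i <- r) face_lift (F i).
Proof.
apply: (big_morph _ face_liftD).
by rewrite /face_lift big1 // => x _; rewrite ffunE face_term0.
Qed.

Lemma face_lift_vec (x : face A) : support x = X ->
  face_lift (face_vec k X x) = face_term 1 x.
Proof.
move=> /eqP xX; rewrite /face_lift (bigD1 (Sub x xX : faces_on A X)) //=.
rewrite ffunE eqxx big1 ?addr0 // => y; rewrite ffunE -val_eqE /= => /negPf->.
exact: face_term0.
Qed.

(** If [support y] is not inside [X], the left side vanishes by definition of
    the action and the right side because [y x] kills [upper_annihilated X]. *)
Lemma face_lift_act y (x : faces_on A X) :
  face_lift (face_act k y x) * upper_annihilated X =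
  face_term 1 (mmul y (val x)) * upper_annihilated X.
Proof.
have xX := faces_onP x; rewrite /face_act xX; case: ifP => yX.
  by rewrite face_lift_vec // support_mulr ?xX.
have yxX : ~~ (support (mmul y (val x)) <= X)%VS.
  by have := support_mulS y (val x) (val x); rewrite xX yX => ->.
rewrite mul_upper_annihilated //.
by rewrite /face_lift big1 ?mul0r // => z _; rewrite ffunE face_term0.
Qed.

Lemma mul_face_lift a u : a * face_lift u =
  \sum_y \sum_(x : faces_on A X)
     face_term (face_coeff a y * u x) (mmul y (val x)).
Proof.
rewrite {1}(face_algebraE a) mulr_suml; apply: eq_bigr => y _.
by rewrite mulr_sumr; apply: eq_bigr => x _; rewrite face_termM.
Qed.

Lemma face_lift_equivariant a (u : face_module A k X) :
  face_lift (a *: u) * upper_annihilated X =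
  a * (face_lift u * upper_annihilated X).
Proof.
rewrite mulrA mul_face_lift face_module_scaleE face_lift_sum.
rewrite [LHS]mulr_suml [RHS]mulr_suml; apply: eq_bigr => y _.
rewrite face_lift_sum [LHS]mulr_suml [RHS]mulr_suml; apply: eq_bigr => x _.
rewrite face_liftZ -mulrA face_lift_act mulrA face_termM.
by rewrite mul1m mulr1.
Qed.

Lemma upper_annihilated_id (u : face_module A k X) :
  upper_annihilated X *: u = u.
Proof.
rewrite /upper_annihilated; elim/big_rec: _ => [|y e yX IH].
  exact: scale1r.
rewrite -scalerA IH scalerBl scale1r [X in _ - X]scale_faceU.
rewrite big1 ?subr0 // => x _.
by rewrite face_act_above ?scaler0.
Qed.

Section RepresentingFace.
Variable x0 : face A.
Hypothesis x0X : support x0 = X.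

Let v0 : face_module A k X := face_vec k X x0.

Lemma face_module_neq0 : v0 != 0.
Proof.
apply/eqP => v00; have := face_sum_vec x0X.
by rewrite -/v0 v00 raddf0 => /esym/eqP; rewrite oner_eq0.
Qed.

(** To lift [f], choose [m] above the image of one basis vector [v0] and send [u]
    to [u e_X m]; this is a lift as [u e_X v0 = u] in [kF_X]. *)
Lemma face_module_projective : projective (face_module A k X).
Proof.
move=> M N g f gsurj; have [m gm] := gsurj (f v0).
pose h (u : face_module A k X) : M := (face_lift u * upper_annihilated X) *: m.
have h_lin : linear h.
  move=> a u v; rewrite /h face_liftD mulrDl scalerDl.
  by rewrite face_lift_equivariant scalerA.
pose hL : {linear face_module A k X -> M} := HB.pack h
  (GRing.isLinear.Build kF (face_module A k X) M *:%R h h_lin).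
exists hL => u; rewrite /= /h linearZ /= gm -linearZ /= -scalerA.
rewrite upper_annihilated_id; congr (f _).
by rewrite [LHS]face_lift_scale face_sum_vec // scale1r.
Qed.

(** The component of [v0] with non-zero sum generates the whole module. *)
Lemma face_module_indecomposable : indecomposable (face_module A k X).
Proof.
split; first by exists v0; exact: face_module_neq0.
move=> U V Usub Vsub [UV UV0]; have [u [v [Uu Vv e]]] := UV v0.
have [u0|u0] := eqVneq (face_sum u) 0; [left|right] => w Ww.
  apply: UV0 => //; apply: (face_generates Vsub Vv).
  have := face_sum_vec x0X; rewrite -/v0 e raddfD /= u0 add0r => ->.
  exact: oner_neq0.
by apply: UV0 => //; exact: (face_generates Usub Uu).
Qed.

Lemma face_sum_eq0_span u :
  (u \in difference_span A k X) = (face_sum u == 0).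
Proof.
apply/idP/eqP => [|u0].
  rewrite /difference_span; set s := [seq _ | _ <- _, _ <- _] => us.
  rewrite (coord_span (X := in_tuple s) us) raddf_sum big1 // => i _.
  have /allpairsP[[y y'] [_ _ /= ->]] : s`_i \in s by apply: mem_nth.
  by rewrite /= linearZ /= raddfB /= !face_sum_vec ?faces_onP // subrr mulr0.
(* As the coordinates add up to zero, the vector of one fixed face can be
   subtracted from every basis vector. *)
have /eqP xX := x0X; pose y0 : faces_on A X := Sub x0 xX.
have -> : u = \sum_(y : faces_on A X)
    u y *: (face_vec k X (val y) - face_vec k X (val y0)).
  transitivity (u - face_sum u *: face_vec k X (val y0)).
    by rewrite u0 scale0r subr0.
  rewrite {1}[u]face_spaceE scaler_suml -sumrB.
  by apply: eq_bigr => y _; rewrite scalerBr.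
apply: rpred_sum => y _; apply: rpredZ; apply: memv_span.
by apply/allpairsP; exists (y, y0); rewrite !mem_enum.
Qed.

(** The kernel of [face_sum] is the greatest proper submodule. *)
Lemma face_module_radical :
  radical (face_module A k X) = [set u : face_space A k X | face_sum u == 0].
Proof.
pose K : {pred face_module A k X} := [pred u | face_sum u == 0].
have Ksub : GRing.submod_closed K.
  split; first by rewrite !inE raddf0.
  move=> a u v; rewrite !inE raddfD /= face_sum_scale => /eqP-> /eqP->.
  by rewrite mulr0 addr0.
have Kproper : proper_submodule K.
  split=> //; exists v0; rewrite !inE face_sum_vec //; exact: oner_neq0.
have NK (N : {pred face_module A k X}) : proper_submodule N -> {subset N <= K}.
  move=> [Nsub [w Nw]] u Nu; rewrite !inE; apply: contraNT Nw => u0.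
  exact: (face_generates Nsub Nu).
apply/seteqP; split=> [u|u uK N [Nproper Nmax]].
  by move=> /(_ K); apply; split=> // N' N'proper _; apply: NK.
by apply: (Nmax K Kproper (NK N Nproper)).
Qed.

End RepresentingFace.
End FaceModule.

(** * Classification of the projective indecomposables *)

(** A non-zero projective module differs from its radical: otherwise the
    coordinates in a dual basis would all be killed by the characters, and
    [eq0_of_radical_coefficients] would apply. *)
Lemma projective_top (P : lmodType kF) :
  projective P -> (exists p : P, p != 0) ->
  exists (f : P -> kF) (z : face A) (p : P),
    (forall a u v, f (a *: u + v) = a * f u + f v) /\
    coeff_sum_below (support z) (f p) != 0.
Proof.
move=> projP [p0 p0n0]; have [h hE] := projective_dual_basis projP.
apply: contrapT => no; case/eqP: p0n0; apply: eq0_of_radical_coefficients => p.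
exists P, (msupp (h p)), (fun q => (h p)@_q), id.
split=> [|q z]; first exact: hE.
apply/eqP/negPn/negP => c0; apply: no.
exists (fun p => (h p)@_q), z, p; split=> //.
by move=> a u v; rewrite linearP mcoeffD mcoeffZ.
Qed.

Lemma projective_indecomposable_face_module (P : lmodType kF) :
  projective P -> indecomposable P ->
  exists z : face A, isomorphic P (face_module A k (support z)).
Proof.
move=> projP indP; have [P0 _] := indP.
have [f [z [p [f_lin fp]]]] := projective_top projP P0.
exists z; set X := support z; pose Q := face_module A k X.
pose v0 : Q := face_vec k X z.
pose g (q : P) : Q := f q *: v0.
have g_lin : linear g by move=> a u v; rewrite /g f_lin scalerDl scalerA.
pose gL : {linear P -> Q} :=
  HB.pack g (GRing.isLinear.Build kF P Q *:%R g g_lin).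
exists gL; apply: indecomposable_surj => //.
- exact: (@face_module_projective X z).
- by exists v0; exact: face_module_neq0.
pose I : {pred Q} := [pred v | `[< exists q, g q = v >]].
have Isub : GRing.submod_closed I.
  split; first by apply/asboolP; exists 0; rewrite -[g]/(gL : P -> Q) linear0.
  move=> a _ _ /asboolP[x <-] /asboolP[y <-].
  by apply/asboolP; exists (a *: x + y); rewrite g_lin.
move=> v; apply/asboolP; apply: (face_generates Isub (u := g p)).
  by apply/asboolP; exists p.
by rewrite face_sum_scale face_sum_vec // mulr1.
Qed.

End FaceAlgebra.

Theorem proposition6p2 (R : realType) (d : nat) (A : arrangement R d)
    (k : fieldType) :
  [/\ forall X : {vspace 'rV[R]_d}, X \in intersection_lattice A ->
        projective (face_module A k X) /\ indecomposable (face_module A k X),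
      forall P : lmodType (face_algebra A k),
        projective P -> indecomposable P ->
        exists2 X : {vspace 'rV[R]_d}, X \in intersection_lattice A &
          isomorphic P (face_module A k X)
    & forall X : {vspace 'rV[R]_d}, X \in intersection_lattice A ->
        radical (face_module A k X) =
          [set u : face_space A k X | u \in difference_span A k X]].
Proof.
split=> [X /imfsetP[/= x _ ->]|P projP indP|X /imfsetP[/= x _ ->]].
- by split; [exact: (@face_module_projective _ _ _ _ _ x)
            |exact: (@face_module_indecomposable _ _ _ _ _ x)].
- have [z Pz] := projective_indecomposable_face_module projP indP.
  by exists (Defs.support z) => //; apply/imfsetP; exists z; rewrite // inE.
rewrite (@face_module_radical _ _ _ _ _ x) //; apply/seteqP.
by split=> u; rewrite /= (@face_sum_eq0_span _ _ _ _ _ x).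
Qed.
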